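(* Let $R=2$, $\alpha=1/4$ and let $\gamma>0$ be fixed. Then the power $\mathcal{P}=\mathcal{P}(\rho)$ of the randomization test (defined in the context), regarded as a function of the absolute correlation $\rho=|r_{12}|\in[0,1)$ between the two unmirrored allocations, is monotonically (strictly) decreasing in $\rho$.
   Context: Power model. An experiment with $n$ subjects (half treated, half control) uses $R$ allocation vectors $w_1,\dots,w_R\in\{-1,+1\}^n$ together with their mirrors $-w_1,\dots,-w_R$. Assume that the observed covariate imbalance is zero, that the pairwise allocation correlations $r_{ij}=w_i^\top w_j/n$ satisfy $|r_{ij}|=\rho$ for all $i\ne j$, and that the standardized imbalances in the unobserved response component are jointly normal, standardized and equicorrelated with correlation $\rho$. With $\gamma=\sqrt n\,\beta$ the sample-size-scaled treatment effect, this amounts to the following. Let $Z_0,Z_1,\dots,Z_R$ be i.i.d. standard normal and define the (scaled) treatment effect estimates when the experiment is run with $w_1$ as $$V_{1,1}=\sqrt{\rho}\,Z_0+\sqrt{1-\rho}\,Z_1+\gamma,\qquad V_{1,j}=\sqrt{\rho}\,Z_0+\sqrt{1-\rho}\,Z_j+\rho\gamma\quad(j=2,\dots,R),$$ with mirror estimates $V_{1,j}^m=-V_{1,j}$ for $j=1,\dots,R$. The power of the level-$\alpha$ randomization test is $$\mathcal{P}=\mathbb{P}\Big(V_{1,1}>\mathrm{Quantile}\big[\{V_{1,1},V_{1,1}^m,\dots,V_{1,R},V_{1,R}^m\},\,1-\alpha\big]\Big),$$ where $\mathrm{Quantile}[L,1-\alpha]$ of a finite list $L$ is the smallest entry $x$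 of $L$ such that at least a fraction $1-\alpha$ of the entries of $L$ are $\le x$. For $R=2$, $\alpha=1/4$ the event is that $V_{1,1}$ is the strict maximum of the four estimates. *)

(* Defs.v *)
From HB Require Import structures.
From mathcomp Require Import all_boot all_order all_algebra.
From mathcomp Require Import all_classical all_reals all_analysis.

Set Implicit Arguments.
Unset Strict Implicit.
Unset Printing Implicit Defensive.

Import Order.TTheory GRing.Theory Num.Theory.

Local Open Scope classical_set_scope.
Local Open Scope ring_scope.

Section Probability.
Context {d : measure_display} {T : measurableType d} {R : realType}.
Variable P : probability T R.

Definition mutually_independent (I : finType) (X : I -> {RV P >-> R}) : Prop :=
  forall (J : {set I}) (B : I -> set R),
    (forall i, i \in J -> measurable (B i)) ->
    P [set t | forall i, i \in J -> B i (X i t)] =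
    (\prod_(i in J) P (X i @^-1` B i))%E.

(* The two laws are compared on measurable sets only: [distribution P X] and
   [normal_prob 0 1], as functions on all sets of reals, have unspecified
   values on non-measurable sets. *)
Definition standard_normal (X : {RV P >-> R}) : Prop :=
  forall A : set R, measurable A -> distribution P X A = normal_prob 0 1 A.

Definition iid_standard_normal (I : finType) (X : I -> {RV P >-> R}) : Prop :=
  mutually_independent X /\ forall i, standard_normal (X i).

End Probability.

(* The smallest entry x of L such that at least a fraction p of the entries of
   L, counted with multiplicity, are at most x (0 if there is no such entry,
   which for p <= 1 happens only when L is empty). *)
Definition quantile (R : realType) (L : seq R) (p : R) : R :=
  head 0 (sort <=%R
    [seq x <- L | p * (size L)%:R <= (count (fun y => y <= x) L)%:R]).

Section PowerModel.
Context {R : realType}.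
(* [m] is the number R of unmirrored allocations. The index 0 of 'I_m.+1 is
   that of the common component Z_0, and the indices 1, ..., m are those of the
   allocations w_1, ..., w_m. *)
Variables (m : nat) (rho gamma : R).

(* V_{1,j}, for j != 0, at the values z = (z_0, ..., z_m) of the Z_i *)
Definition estimate (z : 'I_m.+1 -> R) (j : 'I_m.+1) : R :=
  Num.sqrt rho * z ord0 + Num.sqrt (1 - rho) * z j
    + (if j == 1%N :> nat then gamma else rho * gamma).

Definition mirror_estimate (z : 'I_m.+1 -> R) (j : 'I_m.+1) : R :=
  - estimate z j.

Definition estimates (z : 'I_m.+1 -> R) : seq R :=
  flatten [seq [:: estimate z j; mirror_estimate z j]
          | j <- enum 'I_m.+1 & j != ord0].

Definition rejects (alpha : R) (z : 'I_m.+1 -> R) : Prop :=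
  quantile (estimates z) (1 - alpha) < estimate z (inord 1).

End PowerModel.

Definition power (d : measure_display) (T : measurableType d) (R : realType)
    (P : probability T R) (m : nat) (Z : 'I_m.+1 -> {RV P >-> R})
    (alpha gamma rho : R) : \bar R :=
  P [set t | rejects rho gamma alpha (fun i => Z i t)].

(* Main.v *)
Require Import Defs.
From HB Require Import structures.
From mathcomp Require Import all_boot all_order all_algebra.
From mathcomp Require Import all_classical all_reals all_analysis.
From mathcomp Require Import measurable_realfun.
From mathcomp Require Import ring lra.

Set Implicit Arguments.
Unset Strict Implicit.
Unset Printing Implicit Defensive.

Import Order.TTheory GRing.Theory Num.Theory.

Local Open Scope classical_set_scope.
Local Open Scope ring_scope.

(* Write Phi for the standard normal distribution function. With R = 2 and
   alpha = 1/4 the test rejects iff V_{1,1} > |V_{1,2}|, i.e. iff both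
   V_{1,1} - V_{1,2} and V_{1,1} + V_{1,2} are positive. These two variables are
   positive multiples of U + gamma sqrt((1 - rho)/2) and
   Y + gamma sqrt((1 + rho)/2), where (U, Y) arises from (Z_0, Z_1, Z_2) by two
   plane rotations and so consists of independent standard normals. Hence the
   power is Phi(x) Phi(y) with x = gamma sqrt((1 - rho)/2) and
   y = gamma sqrt((1 + rho)/2).

   Rotation invariance of the Gaussian product is obtained by writing a rotation
   as a product of three shears, each of which preserves the iterated Lebesgue
   integral by translation invariance and Tonelli.

   When rho grows, x^2 + y^2 = gamma^2 is constant while x <= y move apart to
   x' < x and y' > y. As x + x' < y + y', the step y' - y is shorter than x - x',
   and the normal density is larger on the latter interval; so Phi gains less
   from y to y' than it loses from x to x'. In the product the gain is moreover
   weighted by Phi(x'), and the loss by the larger Phi(y). *)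

(** * Translations, and integration against the normal law *)

Section Gauss.
Context {R : realType}.
Local Notation mu := (@lebesgue_measure R).
Local Notation N := (normal_prob (0 : R) 1).
Local Notation phi := (normal_pdf (0 : R) 1).

(** The pushforward of [mu] under a translation has the right value on half-open intervals, hence
    equals [mu] by uniqueness of Lebesgue measure. *)
Lemma integral_shift (c : R) (f : R -> \bar R) :
  measurable_fun [set: R] f -> (forall x, 0 <= f x)%E ->
  (\int[mu]_x f (x + c)%R = \int[mu]_x f x)%E.
Proof.
move=> mf f0.
have mc : measurable_fun setT (fun x : R => x + c : measurableTypeR R).
  exact: measurable_funD.
have shift_mu (A : set R) : measurable A ->
    pushforward mu (fun x => x + c : measurableTypeR R) A = mu A.
  move=> mA; apply/esym/lebesgue_measure_unique => //= _ [[a b]] _ <-.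
  rewrite /pushforward.
  have -> : (fun x : R => x + c) @^-1` `]a, b]%classic = `]a - c, b - c]%classic.
    apply/seteqP; split => x /=; rewrite !in_itv/= ltrBlDr lerBrDr//.
  rewrite !lebesgue_measure_itv/= !lte_fin ltrD2r; case: ifP => // _.
  by rewrite -!EFinB; congr (_%:E); ring.
transitivity (\int[pushforward mu (fun x => (x + c)%R : measurableTypeR R)]_x f x)%E.
  by rewrite ge0_integral_pushforward.
by apply: eq_measure_integral => A mA _; exact: shift_mu.
Qed.

Lemma measurable_EFin_normal_pdf (D : set R) :
  measurable_fun D (fun x => (phi x)%:E).
Proof.
by apply/measurable_EFinP/measurable_funTS; exact: measurable_normal_pdf.
Qed.

(** The Radon-Nikodym derivative of [N] is almost everywhere [phi], since both integrate to [N E]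
    over every measurable [E]. *)
Lemma integral_normal_prob (f : R -> \bar R) : N.-integrable [set: R] f ->
  (\int[N]_x f x = \int[mu]_x (f x * (phi x)%:E))%E.
Proof.
move=> intf; have mf := measurable_int _ intf.
rewrite -(Radon_Nikodym_change_of_variables (normal_prob_dominates 0 1))//=.
apply: ae_eq_integral => //.
- apply: emeasurable_funM => //; apply: (measurable_int mu).
  by apply: Radon_Nikodym_integrable; exact: normal_prob_dominates.
- by apply: emeasurable_funM => //; exact: measurable_EFin_normal_pdf.
- apply: ae_eqe_mul2l => /=.
  rewrite Radon_NikodymE//=; first exact: normal_prob_dominates.
  move=> abmu.
  case: cid => /= h [h1 h2 h3].
  apply: integral_ae_eq => //=.
  + exact: measurable_EFin_normal_pdf.
  + by move=> E E01 mE; rewrite -h3.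
Qed.

End Gauss.

(** * Shears, rotations and the Gaussian product measure *)

Section Shear.
Context {R : realType}.
Local Notation mu := (@lebesgue_measure R).
Local Notation N := (normal_prob (0 : R) 1).
Local Notation phi := (normal_pdf (0 : R) 1).

Lemma integral_shear2 (a : R) (f : R * R -> \bar R) :
  measurable_fun [set: R * R] f -> (forall z, 0 <= f z)%E ->
  (\int[mu]_x \int[mu]_y f (x, (y + a * x)%R) =
   \int[mu]_x \int[mu]_y f (x, y))%E.
Proof.
move=> mf f0; apply: eq_integral => x _.
by rewrite (integral_shift (a * x) (f := fun y => f (x, y)))//;
  exact: measurable_fun_pair2.
Qed.

(** Tonelli makes [x] the inner variable; for fixed [y] the shear is then a translation. *)
Lemma integral_shear1 (a : R) (f : R * R -> \bar R) :
  measurable_fun [set: R * R] f -> (forall z, 0 <= f z)%E ->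
  (\int[mu]_x \int[mu]_y f ((x + a * y)%R, y) =
   \int[mu]_x \int[mu]_y f (x, y))%E.
Proof.
move=> mf f0.
have mg : measurable_fun [set: R * R] (fun z : R * R => (z.1 + a * z.2, z.2)).
  apply: measurable_fun_pair => //; apply: measurable_funD => //.
  exact: measurable_funM.
pose g (z : R * R) := f (z.1 + a * z.2, z.2).
have {}mg : measurable_fun [set: R * R] g := measurableT_comp mf mg.
have swap (h : R * R -> \bar R) : measurable_fun [set: R * R] h ->
    (forall z, 0 <= h z)%E ->
    (\int[mu]_x \int[mu]_y h (x, y) = \int[mu]_y \int[mu]_x h (x, y))%E.
  move=> mh h0; exact: (@fubini_tonelli _ _ _ _ R mu mu h mh h0).
rewrite (swap g)//; last by move=> z; exact: f0.
rewrite (swap f)//.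
apply: eq_integral => y _.
rewrite (integral_shift (a * y) (f := fun x => f (x, y)))//.
exact: measurable_fun_pair1.
Qed.

Definition rotation (c s : R) (z : R * R) : R * R :=
  (c * z.1 - s * z.2, s * z.1 + c * z.2).

Lemma measurable_rotation c s : measurable_fun [set: R * R] (rotation c s).
Proof.
apply: measurable_fun_pair; [apply: measurable_funB|apply: measurable_funD];
  exact: measurable_funM.
Qed.

Lemma integral_rotation (c s : R) (f : R * R -> \bar R) :
  c ^+ 2 + s ^+ 2 = 1 -> 1 + c != 0 ->
  measurable_fun [set: R * R] f -> (forall z, 0 <= f z)%E ->
  (\int[mu]_x \int[mu]_y f (rotation c s (x, y)) =
   \int[mu]_x \int[mu]_y f (x, y))%E.
Proof.
(* For [c] and [s] the cosine and sine of an angle, [t] is the tangent of half the angle. The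
   rotation is a horizontal shear by [- t], a vertical one by [s], and again the horizontal one;
   [1 + c != 0] excludes the half turn, where [t] would be infinite. *)
move=> cs1 c1 mf f0; pose t := s / (1 + c).
pose f1 z := f (z.1 - t * z.2, z.2).
pose f2 z := f1 (z.1, z.2 + s * z.1).
have mf1 : measurable_fun [set: R * R] f1.
  apply: (measurableT_comp mf); apply: measurable_fun_pair => //.
  by apply: measurable_funB => //; exact: measurable_funM.
have mf2 : measurable_fun [set: R * R] f2.
  apply: (measurableT_comp mf1); apply: measurable_fun_pair => //.
  by apply: measurable_funD => //; exact: measurable_funM.
have tE : t * (1 + c) = s by rewrite /t divfK.
have stE : s * t = 1 - c.
  apply: (mulIf c1); rewrite -mulrA tE -expr2 (_ : s ^+ 2 = 1 - c ^+ 2); first by ring.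
  by rewrite -cs1; ring.
transitivity (\int[mu]_x \int[mu]_y f2 ((x + (- t) * y)%R, y))%E.
  apply: eq_integral => x _; apply: eq_integral => y _.
  rewrite /f2 /f1 /rotation/=; congr (f (_, _)).
    transitivity ((1 - s * t) * x - t * (2 - s * t) * y); last by ring.
    by rewrite stE (_ : t * (2 - (1 - c)) = s); [ring|rewrite -[RHS]tE; ring].
  by transitivity (s * x + (1 - s * t) * y); [rewrite stE; ring|ring].
rewrite integral_shear1//; last by move=> z; exact: f0.
rewrite (integral_shear2 s (f := f1))//; last by move=> z; exact: f0.
transitivity (\int[mu]_x \int[mu]_y f ((x + (- t) * y)%R, y))%E.
  by apply: eq_integral => x _; apply: eq_integral => y _; rewrite /f1 mulNr.
exact: integral_shear1.
Qed.

Lemma normal_prodE (E : set (R * R)) : measurable E ->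
  ((N \x N) E = \int[mu]_x \int[mu]_y (phi x * phi y * \1_E (x, y))%:E)%E.
Proof.
move=> mE; rewrite /product_measure1/= integral_normal_prob; last first.
  apply: (@le_integrable _ _ _ _ _ measurableT _ (cst 1%E)) => //.
  - exact: measurable_fun_xsection.
  - move=> x _ /=; rewrite gee0_abs// normr1 probability_le1//.
    exact: measurable_xsection.
  - by apply: finite_measure_integrable_cst.
apply: eq_integral => x _ /=.
rewrite /normal_prob integral_mkcond/= muleC -ge0_integralZl//=; last 3 first.
- apply/(measurable_restrictT _ _).1; first exact: measurable_xsection.
  exact: measurable_EFin_normal_pdf.
- by move=> y _; apply: erestrict_ge0 => ? _; rewrite lee_fin normal_pdf_ge0.
- by rewrite lee_fin normal_pdf_ge0.
apply: eq_integral => y _; rewrite patchE mem_xsection indicE.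
by case: ifPn; rewrite ?mulr1 ?mulr0 ?mule0 -?EFinM.
Qed.

(** The product density depends only on [x ^+ 2 + y ^+ 2]. *)
Lemma normal_pdf_rotation c s x y : c ^+ 2 + s ^+ 2 = 1 ->
  phi (rotation c s (x, y)).1 * phi (rotation c s (x, y)).2 = phi x * phi y.
Proof.
move=> cs1; rewrite !normal_pdfE ?oner_eq0// /normal_fun !subr0.
rewrite mulrACA [RHS]mulrACA -!expRD/=; congr (_ * expR _).
rewrite expr1n -!mulrDl; congr (_ / _).
transitivity (- ((c ^+ 2 + s ^+ 2) * (x ^+ 2 + y ^+ 2))); first by ring.
by rewrite cs1; ring.
Qed.

Lemma normal_prod_rotation c s (E : set (R * R)) :
  c ^+ 2 + s ^+ 2 = 1 -> 1 + c != 0 -> measurable E ->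
  ((N \x N) (rotation c s @^-1` E) = (N \x N) E)%E.
Proof.
move=> cs1 c1 mE.
have mrE : measurable (rotation c s @^-1` E).
  by rewrite -[X in measurable X]setTI; exact: measurable_rotation.
rewrite (normal_prodE mE) (normal_prodE mrE).
pose f z := (phi z.1 * phi z.2 * \1_E z)%:E.
rewrite -[RHS](integral_rotation (f := f) cs1 c1).
- apply: eq_integral => x _; apply: eq_integral => y _.
  by rewrite -(normal_pdf_rotation x y cs1) /f; congr ((_ * _)%:E).
- apply/measurable_EFinP; apply: measurable_funM => //.
  apply: measurable_funM; apply: measurableT_comp => //; exact: measurable_normal_pdf.
- by move=> z; rewrite lee_fin !mulr_ge0 ?normal_pdf_ge0.
Qed.
End Shear.

(** * Rotating a pair of independent normals on a prescribed event *)

Section PairRotation.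
Context {d : measure_display} {T : measurableType d} {R : realType}.
Variable P : probability T R.
Local Notation N := (normal_prob (0 : R) 1).

(* The event D is to be prescribed by a third variable: this way plane rotations
   suffice to treat three jointly independent normals. *)
Definition normal_pair_on (D : set T) (X Y : T -> R) : Prop :=
  forall B C : set R, measurable B -> measurable C ->
    P (X @^-1` B `&` Y @^-1` C `&` D) = (P D * (N B * N C))%E.

(** Rectangles determine a product measure: the law of the pair under [P] restricted to [D] is the
    product whose first factor is [N] scaled by [P D]. *)
Lemma normal_pair_onE (D : set T) (X Y : T -> R) (E : set (R * R)) :
  measurable D -> measurable_fun [set: T] X -> measurable_fun [set: T] Y ->
  normal_pair_on D X Y -> measurable E ->
  P ((fun t => (X t, Y t)) @^-1` E `&` D) = (P D * (N \x N)%E E)%E.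
Proof.
move=> mD mX mY hXY mE.
have p0 : 0 <= fine (P D) by rewrite fine_ge0.
pose p := NngNum p0.
have pE : (p%:num)%:E = P D by rewrite /= fineK// fin_num_measure.
pose XY (t : T) : measurableTypeR R * measurableTypeR R := (X t, Y t).
have mXY : measurable_fun [set: T] XY by exact: measurable_fun_pair.
transitivity ((mscale p N \x N)%E E); last first.
  by rewrite -pE /product_measure1 ge0_integral_mscale//; exact: measurable_fun_xsection.
apply/esym.
pose nu : {measure set (measurableTypeR R * measurableTypeR R) -> \bar R} :=
  pushforward (mrestr P mD) XY.
apply: (@product_measure_unique _ _ _ _ R (mscale p N) N (nu mXY)) => // B C mB mC.
rewrite /pushforward /mrestr/= /mscale pE -muleA -hXY//.
Qed.

Lemma normal_pair_on_rotation (D : set T) (X Y : T -> R) (c s : R) :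
  measurable D -> measurable_fun [set: T] X -> measurable_fun [set: T] Y ->
  c ^+ 2 + s ^+ 2 = 1 -> 1 + c != 0 ->
  normal_pair_on D X Y ->
  normal_pair_on D (fun t => c * X t - s * Y t) (fun t => s * X t + c * Y t).
Proof.
move=> mD mX mY cs1 c1 hXY B C mB mC.
have mBC : measurable (B `*` C) by exact: measurableX.
rewrite -(product_measure1E N N mB mC) -(normal_prod_rotation cs1 c1 mBC).
rewrite -(normal_pair_onE mD mX mY hXY)//.
by rewrite -[X in measurable X]setTI; exact: measurable_rotation.
Qed.
End PairRotation.

(** * Estimates for the normal distribution function *)

Section Tail.
Context {R : realType}.
Local Notation mu := (@lebesgue_measure R).
Local Notation N := (normal_prob (0 : R) 1).
Local Notation phi := (normal_pdf (0 : R) 1).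

(* The tail starts at - x, so by symmetry this is Phi(x). *)
Definition upper_tail (x : R) : R := fine (N `]- x, +oo[).

Lemma upper_tailE x : N `]- x, +oo[ = (upper_tail x)%:E.
Proof. by rewrite /upper_tail fineK// fin_num_measure. Qed.

Lemma upper_tail_ge0 x : 0 <= upper_tail x.
Proof. by rewrite fine_ge0. Qed.

Lemma upper_tailB x y : x <= y ->
  (upper_tail y)%:E = ((upper_tail x)%:E + N `](- y)%R, (- x)%R])%E.
Proof.
move=> xy; rewrite -!upper_tailE -measureU//.
- congr (N _); apply/seteqP; split => t /=; rewrite !in_itv/= !andbT.
    by move=> yt; case: (ltP (- x) t) => xt; [left|right; rewrite yt].
  by case=> [|/andP[]//]; apply: le_lt_trans; rewrite lerN2.
- by apply/seteqP; split => t //= []; rewrite !in_itv/= andbT => xt /andP[_]; rewrite leNgt xt.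
Qed.

Lemma normal_pdf_le (x y : R) : 0 <= x -> x <= y -> phi (- y) <= phi (- x).
Proof.
move=> x0 xy; rewrite !normal_pdfE ?oner_eq0// ler_wpM2l ?normal_peak_ge0//.
rewrite /normal_fun !subr0 ler_expR !sqrrN ler_wpM2r// ?invr_ge0 ?mulrn_wge0 ?sqr_ge0//.
by rewrite lerN2 ler_sqr ?nnegrE// (le_trans x0).
Qed.

(** The increment is the integral of [phi] over []- y, - x]], where [phi] lies between its values at
    the endpoints because it increases on the negative half-line. *)
Lemma upper_tail_increment (x y : R) : 0 <= x -> x <= y ->
  phi (- y) * (y - x) <= upper_tail y - upper_tail x <= phi (- x) * (y - x).
Proof.
move=> x0 xy.
have phi_cst k : (\int[mu]_(t in `](- y)%R, (- x)%R]) k%:E)%E = (k * (y - x))%:E.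
  rewrite integral_cst//= lebesgue_measure_itv/= lte_fin ltrN2.
  case: ltP => [_|yx]; first by rewrite -EFinB -EFinM; congr (_%:E); ring.
  by rewrite (@le_anti _ _ x y) ?xy// subrr mulr0 mule0.
have -> : upper_tail y - upper_tail x = fine (N `]- y, - x]).
  apply: EFin_inj; rewrite EFinB (upper_tailB xy) addeAC subee// [LHS]add0e.
  by rewrite fineK// fin_num_measure.
rewrite -lee_fin -[X in _ && X]lee_fin fineK ?fin_num_measure// -!phi_cst.
apply/andP; split; apply: ge0_le_integral => //=.
- by move=> t _; rewrite lee_fin normal_pdf_ge0.
- exact: measurable_EFin_normal_pdf.
- move=> t; rewrite in_itv/= lee_fin => /andP[yt tx].
  by rewrite -[t]opprK normal_pdf_le//; lra.
- by move=> t _; rewrite lee_fin normal_pdf_ge0.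
- exact: measurable_EFin_normal_pdf.
- move=> t; rewrite in_itv/= lee_fin => /andP[yt tx].
  by rewrite -[t]opprK normal_pdf_le//; lra.
Qed.

Lemma normal_pdf_gt0 (x : R) : 0 < phi x.
Proof. by rewrite normal_pdfE ?oner_eq0// mulr_gt0 ?normal_peak_gt0 ?oner_eq0 ?expR_gt0. Qed.

Lemma upper_tail_mul_lt (x' x y y' : R) :
  0 <= x' -> x' < x -> x <= y -> x' ^+ 2 + y' ^+ 2 = x ^+ 2 + y ^+ 2 -> 0 <= y' ->
  upper_tail x' * upper_tail y' < upper_tail x * upper_tail y.
Proof.
move=> x'0 x'x xy sq y'0.
have yy' : y < y' by rewrite -ltr_sqr ?nnegrE//; nra.
have [lx _] := andP (upper_tail_increment x'0 (ltW x'x)).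
have y0 : 0 <= y by lra.
have [_ uy] := andP (upper_tail_increment y0 (ltW yy')).
have x0 : 0 <= x by lra.
have pxy := normal_pdf_le x0 xy.
have px := normal_pdf_gt0 (- x).
have py := normal_pdf_gt0 (- y).
have gap : y' - y < x - x'.
  (* The equal sums of squares give [(y' - y) * (y' + y) = (x - x') * (x + x')], and
     [x + x' < y' + y]. *)
  rewrite -(@ltr_pM2r _ (y' + y)); last by lra.
  by nra.
have [l0 _] := andP (upper_tail_increment (lexx 0) y0).
have Uy : 0 < upper_tail y.
  have := upper_tail_ge0 0.
  have : 0 < phi (- y) * (y - 0) by rewrite mulr_gt0//; lra.
  by lra.
have x'y : x' <= y by lra.
have [l1 _] := andP (upper_tail_increment x'0 x'y).
have Ux'y : upper_tail x' <= upper_tail y by nra.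
have U0 := upper_tail_ge0 x'.
have DD : upper_tail y' - upper_tail y < upper_tail x - upper_tail x' by nra.
have [l' _] := andP (upper_tail_increment y0 (ltW yy')).
have py' := normal_pdf_gt0 (- y').
have D'0 : 0 <= upper_tail y' - upper_tail y by nra.
(* With U for [upper_tail], [D1] and [D2] chain to U(x')(U(y') - U(y)) <= U(y)(U(y') - U(y)) <
   U(y)(U(x) - U(x')); adding U(x')U(y) to both ends gives the claim. *)
have D1 := ltr_pM2r Uy (upper_tail y' - upper_tail y) (upper_tail x - upper_tail x').
rewrite DD in D1.
have D2 := ler_wpM2l D'0 Ux'y.
lra.
Qed.
End Tail.

(** * The quantile and the rejection event *)

Lemma quantile_lt (R : realType) (L : seq R) (p a : R) :
  has (fun x => p * (size L)%:R <= (count (fun y => y <= x) L)%:R) L ->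
  quantile L p < a <->
  exists2 x, x \in L & (p * (size L)%:R <= (count (fun y => y <= x) L)%:R) /\ x < a.
Proof.
rewrite /quantile; set q := fun x => _ <= _; set s := [seq x <- L | _].
move=> /hasP[x0 x0L qx0].
have mem_s x : (x \in sort <=%R s) = (q x && (x \in L)).
  by rewrite mem_sort mem_filter.
have : sorted <=%R (sort <=%R s) by exact: sort_le_sorted.
(* This keeps the default 0 of [head] out: the quantile is a genuine entry, the least admissible
   one. *)
have : x0 \in sort <=%R s by rewrite mem_s qx0.
case: (sort <=%R s) mem_s => [//|h t] mem_s _ /= hs.
have /andP[qh hL] : q h && (h \in L) by rewrite -mem_s mem_head.
split=> [ha|[x xL [qx xa]]]; first by exists h.
have : x \in h :: t by rewrite mem_s xL andbT.
rewrite inE => /predU1P[<-//|xt]; apply: le_lt_trans xa.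
by move/(order_path_min le_trans)/allP : hs; apply.
Qed.

Lemma quantile_pairs_lt (R : realType) (a b : R) :
  quantile [:: a; - a; b; - b] (1 - 1 / 4) < a <-> `|b| < a.
Proof.
(* Three quarters of four entries: an admissible [x] has at least three entries at or below it. *)
have E (n : nat) : ((1 - 1 / 4) * (size [:: a; - a; b; - b])%:R <= n%:R :> R) = (2 < n)%N.
  by rewrite (_ : _ * _ = 3%:R) ?ler_nat//=; field.
have countE (x : R) : - x <= a <= x -> - x <= b <= x ->
    (2 < count (fun y => (y <= x)%R) [:: a; - a; b; - b])%N.
  by move=> /andP[xa ax] /andP[xb bx] /=; rewrite ax bx (lerNl a) (lerNl b) xa xb.
have max_in (x : R) : x = `|a| \/ x = `|b| -> x \in [:: a; - a; b; - b].
  by rewrite !inE => -[->|->]; [case: (ger0P a)|case: (ger0P b)]; rewrite eqxx ?orbT.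
have nonempty : has (fun x : R => (1 - 1 / 4) * (size [:: a; - a; b; - b])%:R <=
    (count (fun y => y <= x) [:: a; - a; b; - b])%:R :> R) [:: a; - a; b; - b].
  apply/hasP; have [ab|/ltW ba] := leP `|a| `|b|.
    exists `|b|; first by apply: max_in; right.
    by rewrite E countE// -ler_norml.
  exists `|a|; first by apply: max_in; left.
  by rewrite E countE// -ler_norml.
apply: (iff_trans (quantile_lt _ nonempty)).
split=> [[x xL [+ xa]]|ba].
  (* As [x < a], the entry [a] is not counted, so all of [- a], [b] and [- b] must be at most
     [x]. *)
  rewrite E /= leNgt xa/= add0n ltr_norml.
  case: (leP (- a) x) => // ax; case: (leP b x) => // bx; case: (leP (-b) x) => // nbx _.
  by apply/andP; split; lra.
exists `|b|; first by apply: max_in; right.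
split=> //; rewrite E/= leNgt ba ler_norm -(normrN b) ler_norm.
by rewrite (le_trans _ (normr_ge0 _))//; have := normr_ge0 b; lra.
Qed.

Lemma estimatesE (R : realType) (rho gamma : R) (z : 'I_3 -> R) :
  let a := estimate rho gamma z (inord 1) in
  let b := estimate rho gamma z (inord 2) in
  estimates rho gamma z = [:: a; - a; b; - b].
Proof.
move=> a b; rewrite /estimates !enum_ordSl (size0nil (size_enum_ord 0))/=.
have -> : lift ord0 ord0 = inord 1 :> 'I_3 by apply/val_inj; rewrite /= inordK.
have -> : lift ord0 (lift ord0 ord0) = inord 2 :> 'I_3.
  by apply/val_inj; rewrite /= inordK.
by [].
Qed.

Lemma rejects_quarter (R : realType) (rho gamma : R) (z : 'I_3 -> R) :
  rejects rho gamma (1 / 4) z <->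
  `|estimate rho gamma z (inord 2)| < estimate rho gamma z (inord 1).
Proof. by rewrite /rejects estimatesE; exact: quantile_pairs_lt. Qed.

(** * Two successive rotations of the three normals *)

Section Rotated.
Context {d : measure_display} {T : measurableType d} {R : realType}.
Variables (P : probability T R) (Z : 'I_3 -> {RV P >-> R}).
Hypothesis hZ : iid_standard_normal Z.
Local Notation N := (normal_prob (0 : R) 1).

Let i0 : 'I_3 := ord0.
Let i1 : 'I_3 := inord 1.
Let i2 : 'I_3 := inord 2.

Let ZE i (A : set R) : measurable A -> P (Z i @^-1` A) = N A.
Proof. by move=> mA; rewrite -(hZ.2 i A mA). Qed.

Lemma normal_pair_on_iid (A : set R) : measurable A ->
  normal_pair_on P (Z i0 @^-1` A) (Z i1) (Z i2).
Proof.
move=> mA B C mB mC.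
pose F (i : 'I_3) : set R := if i == i0 then A else if i == i1 then B else C.
have mF i : measurable (F i) by rewrite /F; case: ifP => // _; case: ifP.
have [v1 v2] : i1 = 1%N :> nat /\ i2 = 2%N :> nat by rewrite !inordK.
have F0 : F i0 = A by [].
have F1 : F i1 = B by rewrite /F eqxx -val_eqE/= v1.
have F2 : F i2 = C by rewrite /F -!val_eqE/= v2 v1.
have liftE : (lift ord0 ord0 = i1 :> 'I_3) * (lift ord0 (lift ord0 ord0) = i2 :> 'I_3).
  by split; apply/val_inj; rewrite /= ?v1 ?v2.
have I3 (i : 'I_3) : [|| i == i0, i == i1 | i == i2].
  by rewrite -!val_eqE/= v1 v2; case: i => -[|[|[]]].
have := hZ.1 [set: 'I_3]%SET F (fun i _ => mF i).
rewrite big_mkcond/= !big_ord_recl big_ord0 !inE !liftE F0 F1 F2 mule1 !ZE//.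
move=> <-; congr (P _); apply/seteqP; split => t /=.
  by move=> [[Bt Ct] At] i _; case/or3P: (I3 i) => /eqP ->; rewrite ?F0 ?F1 ?F2.
move=> h; have := h i0; have := h i1; have := h i2.
by rewrite F0 F1 F2 !inE => /(_ isT) ? /(_ isT) ? /(_ isT).
Qed.

Variables c s : R.
Hypotheses (cs1 : c ^+ 2 + s ^+ 2 = 1) (c1 : 1 + c != 0).
Variable k : R.
Hypotheses (kk1 : k ^+ 2 + k ^+ 2 = 1) (k1 : 1 + k != 0).

(** First rotation: [k] is both its cosine and its sine, and [Z i0] enters only through the
    prescribed event. *)
Let U t := k * Z i1 t - k * Z i2 t.
Let W t := k * Z i1 t + k * Z i2 t.

Let mU : measurable_fun [set: T] U.
Proof. by apply: measurable_funB; exact: measurable_funM. Qed.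

Let mW : measurable_fun [set: T] W.
Proof. by apply: measurable_funD; exact: measurable_funM. Qed.

Let UWE (A B C : set R) : measurable A -> measurable B -> measurable C ->
  P (U @^-1` B `&` W @^-1` C `&` Z i0 @^-1` A) = (N A * (N B * N C))%E.
Proof.
move=> mA mB mC; rewrite -(ZE i0 mA).
apply: (normal_pair_on_rotation _ _ _ kk1 k1 (normal_pair_on_iid mA)) => //.
by rewrite -[X in measurable X]setTI; exact: measurable_funP.
Qed.

Let NT : N setT = 1%E. Proof. exact: probability_setT. Qed.

(** By [UWE] the roles can be exchanged: the event on [U] is now the prescribed one, and the second
    rotation mixes [W] with [Z i0]. Only its first coordinate is kept. *)
Lemma independent_rotated (A B : set R) : measurable A -> measurable B ->
  P (U @^-1` A `&` (fun t => c * W t - s * Z i0 t) @^-1` B) = (N A * N B)%E.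
Proof.
move=> mA mB.
have UE : P (U @^-1` A) = N A.
  have := UWE measurableT mA measurableT.
  by rewrite !preimage_setT !setIT NT mul1e mule1.
have WZ : normal_pair_on P (U @^-1` A) W (Z i0).
  move=> C D mC mD; rewrite UE [RHS]muleA [RHS]muleC -UWE//.
  by rewrite setIC setIA.
have mUA : measurable (U @^-1` A) by rewrite -[X in measurable X]setTI; exact: mU.
have := normal_pair_on_rotation mUA mW (measurable_funP (Z i0)) cs1 c1 WZ mB measurableT.
by rewrite preimage_setT setIT NT mule1 UE setIC.
Qed.
End Rotated.

(** * Closed form of the power, and its monotonicity *)

Lemma powerE (d : measure_display) (T : measurableType d) (R : realType)
    (P : probability T R) (Z : 'I_3 -> {RV P >-> R}) (gamma rho : R) :
  iid_standard_normal Z -> 0 <= rho < 1 ->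
  power Z (1 / 4) gamma rho =
  (upper_tail (gamma * Num.sqrt (1 - rho) / Num.sqrt 2) *
   upper_tail (gamma * Num.sqrt (1 + rho) / Num.sqrt 2))%:E.
Proof.
move=> hZ /andP[rho0 rho1].
set a := Num.sqrt (1 - rho); set b := Num.sqrt (1 + rho).
set q := Num.sqrt 2; pose r := Num.sqrt rho.
have a0 : 0 < a by rewrite sqrtr_gt0; lra.
have b0 : 0 < b by rewrite sqrtr_gt0; lra.
have q0 : 0 < q by rewrite sqrtr_gt0; lra.
have aE : a ^+ 2 = 1 - rho by rewrite sqr_sqrtr//; lra.
have bE : b ^+ 2 = 1 + rho by rewrite sqr_sqrtr//; lra.
have qE : q ^+ 2 = 2 by rewrite sqr_sqrtr.
have rE : r ^+ 2 = rho by rewrite sqr_sqrtr.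
have [qn bn] : q != 0 /\ b != 0 by rewrite !gt_eqF.
(* The random part of V_{1,1} + V_{1,2} is [q] times [a] W + [q * r] Z_0 with W = (Z_1 + Z_2) / [q];
   dividing by its norm [b], as [a ^+ 2 + 2 * rho = b ^+ 2], gives [c] and [- s]. *)
pose k := q^-1; pose c := a / b; pose s := - (q * r / b).
have kk1 : k ^+ 2 + k ^+ 2 = 1 by rewrite exprVn qE; field.
have k1 : 1 + k != 0 by rewrite gt_eqF// addr_gt0// invr_gt0.
have c1 : 1 + c != 0 by rewrite gt_eqF// addr_gt0// divr_gt0.
have cs1 : c ^+ 2 + s ^+ 2 = 1.
  rewrite sqrrN !exprMn exprVn aE bE qE rE; field.
  by rewrite gt_eqF//; lra.
rewrite EFinM -!upper_tailE -(independent_rotated hZ cs1 c1 kk1 k1)//.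
have estimateE (z : 'I_3 -> R) :
    (`|estimate rho gamma z (inord 2)| < estimate rho gamma z (inord 1)) =
    (- (gamma * a / q) < k * z (inord 1) - k * z (inord 2)) &&
    (- (gamma * b / q) <
       c * (k * z (inord 1) + k * z (inord 2)) - s * z ord0).
  rewrite /estimate !inordK//= -/a -/r.
  set z0 := z ord0; set z1 := z (inord 1); set z2 := z (inord 2).
  (* The difference and the sum of the two estimates are [a * q] and [b * q] times the rotated
     expressions. *)
  rewrite ltr_norml andbC; congr (_ && _); rewrite -subr_gt0 -[RHS]subr_gt0.
    rewrite -[RHS](pmulr_rgt0 _ (mulr_gt0 a0 q0)); congr (0 < _).
    transitivity (a * (z1 - z2) + a ^+ 2 * gamma); first by rewrite aE; ring.
    by rewrite /k; field.
  rewrite -[RHS](pmulr_rgt0 _ (mulr_gt0 b0 q0)); congr (0 < _).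
  transitivity (q ^+ 2 * r * z0 + a * (z1 + z2) + b ^+ 2 * gamma).
    by rewrite qE bE; ring.
  by rewrite /k /c /s; field; rewrite qn.
rewrite /power; congr (P _); apply/seteqP; split => t /=; rewrite rejects_quarter.
  by rewrite estimateE => /andP[h1 h2]; rewrite !in_itv/= h1 h2.
by rewrite estimateE !in_itv/= !andbT => -[-> ->].
Qed.

Theorem theoremA1 (d : measure_display) (T : measurableType d) (R : realType)
    (P : probability T R) (Z : 'I_2.+1 -> {RV P >-> R})
    (hZ : iid_standard_normal Z) (gamma : R) (gamma_gt0 : 0 < gamma)
    (rho1 rho2 : R) (rho1_ge0 : 0 <= rho1) (rho12 : rho1 < rho2)
    (rho2_lt1 : rho2 < 1) :
  (power Z (1 / 4) gamma rho2 < power Z (1 / 4) gamma rho1)%E.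
Proof.
rewrite !powerE//; [|lra|lra]; rewrite lte_fin.
have q0 : 0 < Num.sqrt 2 :> R by rewrite sqrtr_gt0.
have sq (x : R) : 0 <= x ->
    (gamma * Num.sqrt x / Num.sqrt 2) ^+ 2 = gamma ^+ 2 * x / 2.
  by move=> x0; rewrite !exprMn exprVn !sqr_sqrtr.
(* The primed arguments are those at [rho2]; [x <= y] holds because [0 <= rho1], and both sums of
   squares equal [gamma ^+ 2]. *)
apply: upper_tail_mul_lt.
- by rewrite !mulr_ge0 ?invr_ge0 ?sqrtr_ge0 ?ltW.
- rewrite ltr_pM2r ?invr_gt0// ltr_pM2l// ltr_sqrt; lra.
- rewrite ler_pM2r ?invr_gt0// ler_pM2l// ler_sqrt; lra.
- rewrite !sq; [|lra..]; lra.
- by rewrite !mulr_ge0 ?invr_ge0 ?sqrtr_ge0 ?ltW.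
Qed.
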